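(* Let $g \ge h \ge 2$ be integers. If $n \geq 1$ is an integer and $A \subset [n]$ is a $C_h[g]$-set in $\mathbb{Z}$, then $$|A| \le (g-1)^{1/h}\, n^{1-1/h} + O\left(n^{1/2 - 1/(2h)}\right),$$ where the implied constant depends only on $g$ and $h$.
   Context: $[n] = \{1,2,\dots,n\}$. Let $\Gamma$ be an abelian group and $g \geq h \geq 2$ integers. A set $A \subset \Gamma$ is a $C_h[g]$-set if, for any set $X \subset \Gamma$ with $|X| = h$ and any set $\{k_1,\dots,k_g\} \subset \Gamma$ of $g$ distinct elements, at least one of the translates $X + k_i := \{x + k_i : x \in X\}$ is not contained in $A$. Here $\Gamma = \mathbb{Z}$. *)

(* Defs.v *)
From HB Require Import structures.
From mathcomp Require Import all_boot all_order all_algebra.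
From mathcomp Require Import finmap.
From mathcomp Require Import all_classical all_reals all_analysis.
Set Implicit Arguments.
Unset Strict Implicit.
Unset Printing Implicit Defensive.
Import Order.TTheory GRing.Theory Num.Theory.
Local Open Scope classical_set_scope.
Local Open Scope ring_scope.

Definition translate (G : zmodType) (X : {fset G}) (k : G) : {fset G} :=
  [fset (x + k)%R | x in X]%fset.

(* [A] is a C_h[g]-set; the [g] distinct elements k_1, ..., k_g are given as a
   finite set [K] of cardinality [g], and [A] itself may be infinite. *)
Definition is_Chg_set (G : zmodType) (h g : nat) (A : set G) : Prop :=
  forall X K : {fset G}, #|` X|%fset = h -> #|` K|%fset = g ->
    exists2 k : G, k \in K & ~ ([set` translate X k] `<=` A).

(* Main.v *)
(* Count the elements of A in every window of u consecutive integers. There are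
   fewer than n + u relevant windows, and together they see each element of A
   exactly u times. A translation class of h-subsets occurs at most g - 1 times
   in A, so summing 'C(#|window|, h) over all windows gives at most
   (g - 1) * 'C(u, h). The power mean inequality turns this into
   |A| <= (g - 1)^(1/h) (n + u)^(1 - 1/h) + h (n + u) / u,
   and u ~ n^(1/2 + 1/(2h)) balances the two error terms. *)
Require Import Defs.
From HB Require Import structures.
From mathcomp Require Import all_boot all_order all_algebra.
From mathcomp Require Import finmap.
From mathcomp Require Import all_classical all_reals all_analysis.
From mathcomp Require Import zify ring lra.
Import Order.TTheory GRing.Theory Num.Theory.
Local Open Scope classical_set_scope.
Local Open Scope ring_scope.

(* [window A u j] records A on the interval j - u + 1, ..., j, read backwards. *)
Definition window (A : {fset int}) (u j : nat) : {set 'I_u} :=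
  [set x : 'I_u | j%:Z - x%:Z \in A]%SET.

(** If [X] lies in the window at [j], then the translate of [-X] by [j] lies in [A]; the sign comes
    from reading windows backwards. So [g] such positions would be [g] distinct shifts of one h-set
    into [A]. *)
Lemma card_window_translates (h g : nat) (A : {fset int}) (u N : nat)
    (X : {set 'I_u}) :
  is_Chg_set h g [set` A] -> #|X| = h ->
  (#|[set j : 'I_N | X \subset window A u j]%SET| < g)%N.
Proof.
move=> Achg cX; rewrite ltnNge; apply/negP => /card_geqP[s [us ss sJ]].
pose Y := [fset (- (x%:Z))%R | x : 'I_u in X]%fset.
pose K := [fset (j%:Z) | j : 'I_N in s]%fset.
have cY : #|` Y|%fset = h.
  rewrite card_imfset /=; first by rewrite -cX cardE.
  by move=> x y /oppr_inj[] /val_inj.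
have cK : #|` K|%fset = g.
  rewrite card_imfset /=; first by rewrite undup_id.
  by move=> x y [] /val_inj.
have [k /imfsetP[/= j js ->] []] := Achg Y K cY cK.
move=> z /= /imfsetP[/= y /imfsetP[/= x xX ->] ->].
have := sJ _ js; rewrite inE => /fintype.subsetP/(_ x xX).
by rewrite inE addrC.
Qed.

(** Double counting of the pairs (j, X) with [X] an h-subset of the window at [j]: once the sums are
    exchanged, each [X] contributes at most [g.-1]. *)
Lemma sum_bin_card_window (h g : nat) (A : {fset int}) (u N : nat) :
  is_Chg_set h g [set` A] ->
  (\sum_(j < N) 'C(#|window A u j|, h) <= g.-1 * 'C(u, h))%N.
Proof.
move=> Achg.
under eq_bigr => j _ do rewrite -cards_draws -sum1_card big_mkcond /=.
rewrite exchange_big /= -[u in 'C(u, h)]card_ord -cardsT -cards_draws mulnC.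
rewrite -sum_nat_const [leqRHS]big_mkcond /=; apply: leq_sum => X _.
rewrite !inE finset.subsetT /=; case: eqP => [cX|/eqP/negPf cX]; last first.
  by rewrite big1 // => j _; rewrite inE cX andbF.
rewrite -big_mkcond /= sum1_card.
have <- : #|[set j : 'I_N | X \subset window A u j]%SET| =
    #|[pred j : 'I_N |
        X \in [set Y : {set 'I_u} | (Y \subset window A u j) && (#|Y| == h)]%SET]|.
  by apply: eq_card => j; rewrite !inE cX eqxx andbT.
have lt_g := card_window_translates h g A u N X Achg cX.
by rewrite -ltnS (ltn_predK lt_g).
Qed.

Lemma sum_card_window (A : {fset int}) (n u : nat) :
  [set` A] `<=` `[1%R, n%:Z] ->
  (u * #|` A|%fset <= \sum_(j < n + u) #|window A u j|)%N.
Proof.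
move=> An.
under eq_bigr => j _ do rewrite -sum1_card big_mkcond /=.
rewrite exchange_big /= -[u in (u * _)%N]card_ord -sum_nat_const.
apply: leq_sum => x _; rewrite -big_mkcond /= sum1_card.
(* For a fixed offset [x], the element [a] is seen from position [a + x]. Since 1 <= a <= n and 0 <=
   x < u, this lies between 1 and n + u - 1: the absolute value changes nothing and no position
   falls out of range. *)
pose S := [seq `|(a + (x : nat)%:Z)%R|%N | a <- A].
have A1 a : a \in A -> (1 <= a <= n%:Z)%R
  by move=> aA; have aI : a \in `[1%R, n%:Z] := An a aA; move: aI; rewrite in_itv.
have inS k : k \in S -> (k < n + u)%N /\ (k%:Z - (x : nat)%:Z)%R \in A.
  case/mapP => a aA ->; have := A1 a aA; have := ltn_ord x => xu a1.
  split; first lia.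
  by rewrite (_ : _ - _ = a) //; lia.
have uS : uniq S.
  rewrite map_inj_in_uniq ?fset_uniq // => a b /A1 a1 /A1 b1 /= ab.
  by lia.
apply/card_geqP; exists (pmap insub S); split.
- exact: pmap_sub_uniq.
- rewrite size_pmap_sub; transitivity (size S); last by rewrite size_map.
  by apply/eqP; rewrite -all_count; apply/allP => k /inS[].
- move=> j; rewrite mem_pmap_sub => /inS[_ jA].
  by change (x \in window A u j); rewrite inE.
Qed.

(** The factors of [m ^_ h] are m - i with i < h; truncated subtraction covers the case m < h as
    well. *)
Lemma leq_expn_ffact (m h : nat) : ((m - h) ^ h <= m ^_ h)%N.
Proof.
rewrite ffact_prod -[X in (_ ^ X <= _)%N](card_ord h) -prod_nat_const.
by apply: leq_prod => i _; have := ltn_ord i; lia.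
Qed.

Lemma leq_ffact_expn (m h : nat) : (m ^_ h <= m ^ h)%N.
Proof.
rewrite ffact_prod -[X in (_ <= _ ^ X)%N](card_ord h) -prod_nat_const.
by apply: leq_prod => i _; lia.
Qed.

(** Chebyshev's sum inequality for [f] and its h-th power, which are ordered alike. Doubling both
    sides symmetrises them over pairs (i, j), and each pair reduces to (a - b)(a^h - b^h) >= 0,
    which is [key]. *)
Lemma sum_mul_sum_expn (N h : nat) (f : 'I_N -> nat) :
  ((\sum_j f j) * (\sum_j f j ^ h) <= N * \sum_j f j ^ h.+1)%N.
Proof.
rewrite -(leq_pmul2l (isT : (0 < 2)%N)).
have key (a b : nat) : (a * b ^ h + b * a ^ h <= a ^ h.+1 + b ^ h.+1)%N.
  wlog ab : a b / (a <= b)%N.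
    by move=> H; case/orP: (leq_total a b) => /H // H1; rewrite addnC [leqRHS]addnC.
  have abh : (a ^ h <= b ^ h)%N by case: (h) => // k; rewrite leq_exp2r.
  rewrite !expnS; move: ab abh; move: (a ^ h)%N (b ^ h)%N => c d; nia.
have -> : (2 * ((\sum_j f j) * \sum_j f j ^ h) =
    \sum_i \sum_j (f i * f j ^ h + f j * f i ^ h))%N.
  under [RHS]eq_bigr => i _ do rewrite big_split /=.
  rewrite big_split /= [X in _ = (_ + X)%N]exchange_big /= mul2n -addnn.
  by rewrite !big_distrlr.
have -> : (2 * (N * \sum_j f j ^ h.+1) =
    \sum_(i < N) \sum_(j < N) (f i ^ h.+1 + f j ^ h.+1))%N.
  under [RHS]eq_bigr => i _ do rewrite big_split /=.
  rewrite big_split /= [X in _ = (X + _)%N]exchange_big /= mul2n -addnn.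
  by rewrite !sum_nat_const !card_ord.
by apply: leq_sum => i _; apply: leq_sum.
Qed.

Lemma power_mean (N h : nat) (f : 'I_N -> nat) :
  ((\sum_j f j) ^ h.+1 <= N ^ h * \sum_j f j ^ h.+1)%N.
Proof.
elim: h => [|h IHh]; first by rewrite expn1 mul1n.
rewrite expnS; apply: (leq_trans (leq_mul (leqnn _) IHh)).
by rewrite mulnCA expnSr -mulnA leq_mul2l sum_mul_sum_expn orbT.
Qed.

Lemma Chg_set_window_bound (h g : nat) (A : {fset int}) (n u : nat) :
  (0 < h)%N ->
  [set` A] `<=` `[1%R, n%:Z] ->
  is_Chg_set h g [set` A] ->
  exists2 s : nat, (u * #|` A|%fset <= s + (n + u) * h)%N &
    (s ^ h <= (n + u) ^ h.-1 * (g.-1 * u ^ h))%N.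
Proof.
(* Removing [h] from each window size costs at most (n + u) h in total, and makes the h-th power at
   most h! times the binomial coefficient, even for windows with fewer than [h] elements. *)
move=> h0 An Achg; pose f (j : 'I_(n + u)) := (#|window A u j| - h)%N.
exists (\sum_j f j)%N.
  apply: (leq_trans (sum_card_window A n u An)).
  rewrite -[X in (_ + X * _)%N]card_ord -sum_nat_const -big_split /=.
  by apply: leq_sum => j _; rewrite /f [leqRHS]addnC -maxnE leq_maxr.
have := power_mean (n + u) h.-1 f; rewrite (prednK h0) => le_mean.
apply: (leq_trans le_mean); rewrite leq_mul2l; apply/orP; right.
apply: (@leq_trans (h`! * (g.-1 * 'C(u, h)))%N); last first.
  by rewrite mulnCA leq_mul2l mulnC bin_ffact leq_ffact_expn orbT.
apply: leq_trans (leq_mul (leqnn _) (sum_bin_card_window h g A u (n + u) Achg)).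
rewrite big_distrr /=; apply: leq_sum => j _.
by rewrite mulnC bin_ffact leq_expn_ffact.
Qed.

(** Factor out [x]; then (1 + y/x)^(1 - a) <= 1 + y/x, as the base is at least 1 and the exponent at
    most 1. *)
Lemma ler_powRD (R : realType) (x y a : R) : 0 < x -> 0 <= y -> 0 <= a <= 1 ->
  (x + y) `^ (1 - a) <= x `^ (1 - a) + y * x `^ (- a).
Proof.
move=> x0 y0 /andP[a0 a1]; have xD : x != 0 by rewrite gt_eqF.
have -> : x + y = x * (1 + y / x) by field.
have y1 : 1 <= 1 + y / x by rewrite lerDl divr_ge0 // ltW.
rewrite powRM; [|exact: ltW|exact: le_trans y1].
apply: (@le_trans _ _ (x `^ (1 - a) * (1 + y / x))).
  by rewrite ler_wpM2l ?powR_ge0// ler1_powR// lerBlDr lerDl.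
rewrite powRB ?xD ?implybT// powRN (powRr1 (ltW x0)).
by rewrite le_eqVlt; apply/orP; left; apply/eqP; field; rewrite xD gt_eqF// powR_gt0.
Qed.

Lemma powR_root_le (R : realType) (b N s u h : nat) : (0 < h)%N ->
  (s ^ h <= N ^ h.-1 * (b * u ^ h))%N ->
  s%:R <= b%:R `^ h%:R^-1 * N%:R `^ (1 - h%:R^-1) * u%:R :> R.
Proof.
move=> h0 le_s; have hD : h%:R != 0 :> R by rewrite pnatr_eq0 -lt0n.
have root (m : nat) : ((m ^ h)%N%:R : R) `^ h%:R^-1 = m%:R.
  by rewrite natrX -powR_mulrn// -powRrM mulfV// powRr1.
rewrite -(root s) -(root u).
apply: (@le_trans _ _ ((N ^ h.-1 * (b * u ^ h))%N%:R `^ h%:R^-1)).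
  by rewrite ge0_ler_powR ?nnegrE ?invr_ge0 ?ler_nat.
rewrite !natrM !powRM// ?mulr_ge0// (natrX _ N) -(@powR_mulrn R N%:R)// -powRrM.
have -> : h.-1%:R / h%:R = 1 - h%:R^-1 :> R.
  by rewrite -subn1 natrB//; field.
by rewrite mulrCA mulrA.
Qed.

Lemma window_optimization (R : realType) (g h : nat) : (1 < h)%N ->
  exists C : R, forall n : nat, (0 < n)%N -> exists u : nat,
  forall a s : nat, (u * a <= s + (n + u) * h)%N ->
    (s ^ h <= (n + u) ^ h.-1 * (g * u ^ h))%N ->
    a%:R <= g%:R `^ (h%:R^-1) * n%:R `^ (1 - h%:R^-1)
            + C * n%:R `^ (2^-1 - (2 * h%:R)^-1).
Proof.
move=> h1; have h0 : (0 < h)%N by apply: ltnW.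
(* The part [2 * G] pays for replacing n + u by n in the main term, the part [3 * h%:R] for (n + u)
   h / u. *)
pose G : R := g%:R `^ h%:R^-1; exists (2 * G + 3 * h%:R) => n n0.
pose al : R := h%:R^-1.
have al1 : 0 <= al <= 1 by rewrite invr_ge0 ler0n invf_le1 ?ltr0n ?ler1n.
have nD : n%:R != 0 :> R by rewrite pnatr_eq0 -lt0n.
have n1 : 1 <= n%:R :> R by rewrite ler1n.
(* [x] is the ideal real window length: n / x and x n^(-1/h) are both equal to the error term
   [E]. *)
set E := n%:R `^ (2^-1 - _).
pose x : R := n%:R `^ (2^-1 + (2 * h%:R)^-1).
have hal : (2 * h%:R)^-1 = 2^-1 * al :> R by rewrite invfM.
have x1 : 1 <= x.
  rewrite -[leLHS](powRr0 n%:R) /x ler_powR// hal; move: al1; lra.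
have xn : x <= n%:R.
  rewrite -[leRHS](@powRr1 _ n%:R)// /x ler_powR// hal; move: al1; lra.
have xE : x * E = n%:R.
  rewrite /x /E -powRD ?nD ?implybT// -[RHS](@powRr1 _ n%:R)//.
  by congr (_ `^ _); lra.
have xal : x * n%:R `^ (- al) = E.
  rewrite /x /E -powRD ?nD ?implybT//; congr (_ `^ _).
  by rewrite hal; lra.
have E0 : 0 <= E by apply: powR_ge0.
(* Rounding up keeps x <= u <= 2x, the upper bound because x >= 1. *)
pose u := (Num.trunc x).+1; exists u => a s le_a le_s.
have xu : x <= u%:R by rewrite ltW// Num.Theory.truncnS_gt.
have ux : u%:R <= 2 * x.
  rewrite /u -natr1; have : (Num.trunc x)%:R <= x.
    by have /Num.Theory.truncn_itv/andP[] : 0 <= x by exact: le_trans x1.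
  by move: x1; lra.
have u0 : 0 < u%:R :> R by rewrite ltr0n.
have {le_s}le_s := powR_root_le R g (n + u) s u h h0 le_s.
have G0 : 0 <= G by apply: powR_ge0.
have {le_a} : u%:R * a%:R <= s%:R + (n%:R + u%:R) * h%:R :> R.
  by rewrite -natrD -!natrM -natrD ler_nat.
move=> le_a; rewrite -(ler_pM2l u0); apply: (le_trans le_a).
have Npow : (n + u)%N%:R `^ (1 - al) <= n%:R `^ (1 - al) + 2 * E :> R.
  rewrite natrD; apply: (le_trans (ler_powRD R n%:R u%:R al _ _ al1)) => //.
    by rewrite ltr0n.
  by rewrite lerD2l -xal mulrA ler_wpM2r// powR_ge0.
have le_err : (n%:R + u%:R) * h%:R <= u%:R * (3 * h%:R * E).
  have -> : u%:R * (3 * h%:R * E) = (3 * (u%:R * E)) * h%:R by ring.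
  rewrite ler_wpM2r//.
  (* Since u <= 2x <= 2n, the sum n + u is at most 3n, hence at most 3uE. *)
  have : n%:R <= u%:R * E by rewrite -xE ler_wpM2r.
  by move: xn ux; lra.
have : s%:R <= G * (n%:R `^ (1 - al) + 2 * E) * u%:R.
  by apply: (le_trans le_s); rewrite ler_wpM2r// ler_wpM2l.
rewrite -/G -/al; move: le_err; move: (n%:R `^ (1 - al)) => P.
lra.
Qed.

Theorem theorem1 (R : realType) (g h : nat) (hg : (h <= g)%N) (h2 : (2 <= h)%N) :
  exists C : R, forall (n : nat) (A : {fset int}),
    (1 <= n)%N ->
    [set` A] `<=` `[1, n%:Z] ->
    is_Chg_set h g [set` A] ->
    (#|` A|%fset)%:R <=
      (g%:R - 1) `^ (h%:R^-1) * n%:R `^ (1 - h%:R^-1)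
      + C * n%:R `^ (2^-1 - (2 * h%:R)^-1).
Proof.
have [C HC] := window_optimization R g.-1 h h2.
exists C => n A n0 An Achg; have [u Hu] := HC n n0.
have h0 : (0 < h)%N by apply: ltnW.
have [s le_a le_s] := Chg_set_window_bound h g A n u h0 An Achg.
have -> : g%:R - 1 = g.-1%:R :> R.
  by rewrite -subn1 natrB// (leq_trans h0).
exact: Hu le_a le_s.
Qed.
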